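(* Let $n\geq 3$ be odd, let $k,l\geq 1$ be integers, and let $w(n,k)=x_0^kx_1^k\cdots x_{n-1}^k\in F^{k/l}(n)$. Then (a) $w(n,k)^2=1$ in $F^{k/l}(n)$; (b) $w(n,k)=[x_0^l,x_{n-1}^l]$ in $F^{k/l}(n)$.
   Context: For integers $n,k,l\geq 1$, the Fractional Fibonacci group is $$F^{k/l}(n)=\langle x_0,\ldots,x_{n-1}\mid x_i^l x_{i+1}^k=x_{i+2}^l\ (0\leq i<n)\rangle,$$ with subscripts taken modulo $n$. The commutator convention is $[a,b]=a^{-1}b^{-1}ab$. *)

(* Defs.v *)
From HB Require Import structures.
From mathcomp Require Import all_boot boolp.

Set Implicit Arguments.
Unset Strict Implicit.
Unset Printing Implicit Defensive.

Local Open Scope group_scope.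
Local Open Scope quotient_scope.

(* The letter (x, false) stands for the generator x, (x, true) for its formal
   inverse. *)
Notation word X := (seq (X * bool)).

Definition inv_letter X (a : X * bool) : X * bool := (a.1, ~~ a.2).
Definition inv_word X (w : word X) : word X := rev (map (@inv_letter X) w).
Definition pow_letter X (x : X) (m : nat) : word X := nseq m (x, false).

(* A presentation < X | u = v for R u v > is given by its set R of defining
   relations; pres_eq is the congruence they generate on words. *)
Inductive pres_eq (X : Type) (R : word X -> word X -> Prop) :
    word X -> word X -> Prop :=
| pres_refl w : pres_eq R w w
| pres_sym u v : pres_eq R u v -> pres_eq R v u
| pres_trans v u w : pres_eq R u v -> pres_eq R v w -> pres_eq R u w
| pres_cat u u' v v' :
    pres_eq R u u' -> pres_eq R v v' -> pres_eq R (u ++ v) (u' ++ v')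
| pres_cancel a : pres_eq R [:: a; inv_letter a] [::]
| pres_rel u v : R u v -> pres_eq R u v.

Section PresentedGroup.
Variables (X : choiceType) (R : word X -> word X -> Prop).

Definition pres_eqb : rel (word X) := fun u v => `[< pres_eq R u v >].

Lemma pres_eqb_refl : reflexive pres_eqb.
Proof. by move=> w; apply/asboolP/pres_refl. Qed.

Lemma pres_eqb_sym : symmetric pres_eqb.
Proof. by move=> u v; apply/asboolP/asboolP => /pres_sym. Qed.

Lemma pres_eqb_trans : transitive pres_eqb.
Proof.
by move=> v u w /asboolP uv /asboolP vw; apply/asboolP/(pres_trans uv).
Qed.

Canonical pres_equiv :=
  EquivRel pres_eqb pres_eqb_refl pres_eqb_sym pres_eqb_trans.

Definition pres_group := {eq_quot pres_equiv}.
HB.instance Definition _ := EqQuotient.on pres_group.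
HB.instance Definition _ := Choice.on pres_group.

Definition pres_class (w : word X) : pres_group := \pi w.

Lemma pres_classP u v : pres_class u = pres_class v <-> pres_eq R u v.
Proof. by split=> [/eqmodP/asboolP|?]; last exact/eqmodP/asboolP. Qed.

Lemma pres_class_repr (g : pres_group) : pres_class (repr g) = g.
Proof. exact: reprK. Qed.

Lemma repr_pres_class w : pres_eq R (repr (pres_class w)) w.
Proof. exact/pres_classP/pres_class_repr. Qed.

Lemma pres_cancelV a : pres_eq R [:: inv_letter a; a] [::].
Proof.
by case: a => x b; have := pres_cancel R (x, ~~ b); rewrite /inv_letter /= negbK.
Qed.

Lemma pres_mulVw w : pres_eq R (inv_word w ++ w) [::].
Proof.
elim: w => [|a w IHw]; first exact: pres_refl.
rewrite /inv_word /= rev_cons cat_rcons -(cat1s a) -cat1s.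
rewrite !catA -(catA _ [:: inv_letter a] [:: a]).
apply: pres_trans IHw; apply: pres_cat; last exact: pres_refl.
rewrite -[X in pres_eq _ _ X]cats0.
by apply: pres_cat; [exact: pres_refl | exact: pres_cancelV].
Qed.

Lemma inv_wordK : involutive (@inv_word X).
Proof.
move=> w; rewrite /inv_word map_rev revK -map_comp -[RHS]map_id.
by apply: eq_map => -[x b]; rewrite /inv_letter /= negbK.
Qed.

Lemma pres_mulwV w : pres_eq R (w ++ inv_word w) [::].
Proof. by have := pres_mulVw (inv_word w); rewrite inv_wordK. Qed.

Definition pres_mul (g h : pres_group) := pres_class (repr g ++ repr h).
Definition pres_one := pres_class [::].
Definition pres_inv (g : pres_group) := pres_class (inv_word (repr g)).

Fact pres_mulA : associative pres_mul.
Proof.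
move=> a b c; apply/pres_classP.
apply: (@pres_trans _ _ (repr a ++ repr b ++ repr c)).
  by apply: pres_cat; [exact: pres_refl | exact: repr_pres_class].
rewrite catA; apply: pres_sym.
by apply: pres_cat; [exact: repr_pres_class | exact: pres_refl].
Qed.

Fact pres_mul1g : left_id pres_one pres_mul.
Proof.
move=> g; rewrite -[RHS]pres_class_repr; apply/pres_classP.
rewrite -[X in pres_eq _ _ X]cat0s.
by apply: pres_cat; [exact: repr_pres_class | exact: pres_refl].
Qed.

Fact pres_mulg1 : right_id pres_one pres_mul.
Proof.
move=> g; rewrite -[RHS]pres_class_repr; apply/pres_classP.
rewrite -[X in pres_eq _ _ X]cats0.
by apply: pres_cat; [exact: pres_refl | exact: repr_pres_class].
Qed.

Fact pres_mulVg : left_inverse pres_one pres_inv pres_mul.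
Proof.
move=> g; apply/pres_classP; apply: pres_trans (pres_mulVw (repr g)).
by apply: pres_cat; [exact: repr_pres_class | exact: pres_refl].
Qed.

Fact pres_mulgV : right_inverse pres_one pres_inv pres_mul.
Proof.
move=> g; apply/pres_classP; apply: pres_trans (pres_mulwV (repr g)).
by apply: pres_cat; [exact: pres_refl | exact: repr_pres_class].
Qed.

HB.instance Definition _ := isGroup.Build pres_group
  pres_mulA pres_mul1g pres_mulg1 pres_mulVg pres_mulgV.

Definition pres_gen (x : X) : pres_group := pres_class [:: (x, false)].

Lemma pres_class_nil : pres_class [::] = 1.
Proof. by []. Qed.

Lemma pres_class_cat u v : pres_class (u ++ v) = pres_class u * pres_class v.
Proof. by apply/pres_classP/pres_sym/pres_cat; exact: repr_pres_class. Qed.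

Lemma pres_class_pow x m : pres_class (pow_letter x m) = pres_gen x ^+ m.
Proof.
elim: m => [|m IHm]; first by rewrite expg0.
by rewrite expgS -IHm -pres_class_cat.
Qed.

End PresentedGroup.

(* The indices live in 'I_n, where ordS is the successor modulo n. *)
Inductive frac_fib_rel (n k l : nat) : word 'I_n -> word 'I_n -> Prop :=
| FracFibRel (i : 'I_n) :
    frac_fib_rel k l (pow_letter i l ++ pow_letter (ordS i) k)
                     (pow_letter (ordS (ordS i)) l).

Definition frac_fib (n k l : nat) := pres_group (@frac_fib_rel n k l).
HB.instance Definition _ n k l := Group.on (frac_fib n k l).

(* x_i, the subscript i being read modulo n. *)
Definition frac_fib_gen (n k l : nat) (n_gt0 : (0 < n)%N) (i : nat) :
    frac_fib n k l :=
  pres_gen (@frac_fib_rel n k l) (Ordinal (ltn_pmod i n_gt0)).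

Lemma frac_fib_genE n k l (n_gt0 : (0 < n)%N) (i : nat) :
  let x := @frac_fib_gen n k l n_gt0 in
  x i ^+ l * x i.+1 ^+ k = x i.+2 ^+ l.
Proof.
have ordSE j :
    ordS (Ordinal (ltn_pmod j n_gt0)) = Ordinal (ltn_pmod j.+1 n_gt0).
  by apply: val_inj; rewrite /= -addn1 modnDml addn1.
rewrite /= /frac_fib_gen -!ordSE -!pres_class_pow -pres_class_cat.
exact/pres_classP/pres_rel.
Qed.

Definition frac_fib_w (n k l : nat) (n_gt0 : (0 < n)%N) : frac_fib n k l :=
  \prod_(0 <= i < n) frac_fib_gen k l n_gt0 i ^+ k.

(* Main.v *)
(** Put [a i = x_i ^+ l]. The relations say [x_(i+1) ^+ k = (a i)^-1 * a (i+2)],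
    so [a (i+1)] commutes with [(a i)^-1 * a (i+2)]; hence the left-handed
    commutators [C i = a i * a (i+1) * (a i)^-1 * (a (i+1))^-1] satisfy
    [C (i+1) = (C i)^-1]. As [n] is odd, going once around the cycle yields
    [C 0 = (C 0)^-1], so all the [C i] are one involution [C]. Pulling [C] out
    of the partial products of [w] makes them telescope. *)
Require Import Defs.
From mathcomp Require Import all_boot.

Section OddCycle.
Local Open Scope group_scope.

Lemma lcomm_alternate (G : groupType) (a b c : G) :
  commute b (a^-1 * c) -> b * c * b^-1 * c^-1 = (a * b * a^-1 * b^-1)^-1.
Proof.
move=> bc; rewrite !invgM !invgK !mulgA.
have -> : b * c * b^-1 = b * a * (a^-1 * c * b^-1) by rewrite !mulgA mulgK.
have -> : a^-1 * c * b^-1 = b^-1 * (a^-1 * c).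
  by apply: (mulgI b); rewrite mulgA bc mulgK mulVKg.
by rewrite !mulgA mulgK.
Qed.

Variables (G : groupType) (n : nat) (a : nat -> G).
Hypothesis n_odd : odd n.
Hypothesis a_per : forall i, a (i + n)%N = a i.
Hypothesis a_comm : forall i, commute (a i.+1) ((a i)^-1 * a i.+2).

Let C := a 0 * a 1 * (a 0)^-1 * (a 1)^-1.

Lemma odd_cycle_lcomm_alternate i :
  a i * a i.+1 * (a i)^-1 * (a i.+1)^-1 = if odd i then C^-1 else C.
Proof.
elim: i => [//|i IHi].
by rewrite (lcomm_alternate _ _ _ _ (a_comm i)) IHi /=; case: odd; rewrite ?invgK.
Qed.

Lemma odd_cycle_lcomm_invK : C^-1 = C.
Proof.
have := odd_cycle_lcomm_alternate n; rewrite n_odd => <-.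
by rewrite (a_per 0 : a n = _) (a_per 1 : a n.+1 = _).
Qed.

Lemma odd_cycle_swap i : a i * a i.+1 * (a i)^-1 = C * a i.+1.
Proof.
have := odd_cycle_lcomm_alternate i; rewrite odd_cycle_lcomm_invK if_same => <-.
by rewrite mulgVK.
Qed.

(** By [odd_cycle_swap], each new factor contributes one [C], which lands next to the power already
    there. *)
Lemma odd_cycle_partial_prod m :
  \prod_(0 <= i < m) ((a i)^-1 * a i.+2) =
    (a 0)^-1 * (a 1)^-1 * C ^+ m.+1 * (a m * a m.+1).
Proof.
elim: m => [|m IHm].
  (* Written as [C^-1], the single [C] cancels all four outer factors. *)
  rewrite big_geq // expg1 -{1}odd_cycle_lcomm_invK /C !invgM !invgK.
  by rewrite !mulgA !mulgVK mulVg.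
rewrite big_nat_recr //= IHm [C ^+ m.+2]expgSr -!mulgA; do 3!congr (_ * _).
by rewrite !mulgA odd_cycle_swap.
Qed.

Lemma odd_cycle_prod : \prod_(0 <= i < n) ((a i)^-1 * a i.+2) = [~ a 0, a 1].
Proof.
have CC : C * C = 1 by rewrite -{1}odd_cycle_lcomm_invK mulVg.
rewrite odd_cycle_partial_prod.
have -> : C ^+ n.+1 = 1.
  rewrite -(odd_double_half n.+1) /= n_odd /= add0n -mul2n expgnA.
  by rewrite expgS expg1 CC expg1n.
by rewrite mulg1 (a_per 0 : a n = _) (a_per 1 : a n.+1 = _) commgEl /conjg !mulgA.
Qed.

Lemma odd_cycle_commg_sqr : [~ a 0, a 1] ^+ 2 = 1.
Proof.
(* The two commutator conventions differ by a conjugation, so the order carries over. *)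
have CJ : [~ a 0, a 1] = C ^ (a 1 * a 0).
  by rewrite /C commgEl /conjg !invgM !mulgA !mulgVK.
by rewrite CJ -conjXg expgS expg1 -{1}odd_cycle_lcomm_invK mulVg conj1g.
Qed.

End OddCycle.

Theorem theorem5p3 (n k l : nat) (n_ge3 : 3 <= n) (n_odd : odd n)
    (k_ge1 : 1 <= k) (l_ge1 : 1 <= l) :
  let n_gt0 : 0 < n := ltnW (ltnW n_ge3) in
  let x := @frac_fib_gen n k l n_gt0 in
  let w := @frac_fib_w n k l n_gt0 in
  ((w ^+ 2 = 1) /\ (w = [~ x 0 ^+ l, x n.-1 ^+ l]))%g.
Proof.
move=> n_gt0 x w.
have x_per i : x (i + n) = x i.
  by congr (pres_gen _ _); apply: val_inj; rewrite /= modnDr.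
(* The index is shifted by [-1] modulo [n]: [a i] is [x_(i-1) ^+ l]. *)
pose a i := (x (i + n.-1)%N ^+ l)%g.
have shiftE i : (i.+1 + n.-1 = i + n)%N by rewrite addSnnS prednK.
(* The shift makes the product start at [x 0], as [w] does. *)
have aE i : ((a i)^-1 * a i.+2 = x i ^+ k)%g.
  by rewrite /a !addSn -frac_fib_genE mulKg -addSn shiftE -/x x_per.
have a_per i : a (i + n) = a i by rewrite /a addnAC x_per.
have a_comm i : commute (a i.+1) ((a i)^-1 * a i.+2)%g.
  by rewrite aE /a shiftE x_per; apply: commuteX2.
have wE : (w = [~ a 0%N, a 1%N])%g.
  by rewrite -(odd_cycle_prod _ _ _ n_odd a_per a_comm); apply: eq_bigr => i _.
have w2 : (w ^+ 2 = 1)%g.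
  by rewrite wE (odd_cycle_commg_sqr _ _ _ n_odd a_per a_comm).
split=> //.
(* So far [w] is the commutator of [x n.-1 ^+ l] and [x 0 ^+ l]; inverting the involution [w] swaps
   the entries. *)
have -> : (w = w^-1)%g by apply: (mulgI w); rewrite mulgV.
by rewrite wE invgR /a shiftE x_per.
Qed.
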